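(* Let $(X_k)_{k\in\mathbb{N}}$ be Banach spaces, let $T_k\in L(X_k,X_{k-1})$ for $k\ge 2$ with $\sup_{k\ge 2}\|T_k\|<\infty$, and let $B_{(T_k)}$ be the associated shift operator on $\ell^p((X_k)_k,\mathbb{N})$ for some $1\le p<\infty$ (resp. on $c_0((X_k)_k,\mathbb{N})$). The following assertions are equivalent: (1) $B_{(T_k)}$ is mixing; (2) for every $j\in\mathbb{N}$ and every non-empty open subset $U_j$ of $X_j$, there exists $n_0$ such that for every $n\ge n_0$, $$T_{j,j+n}(B_{j+n}(0,1))\cap U_j\neq\emptyset .$$
   Context: $\mathbb{N}=\{1,2,3,\dots\}$; Banach spaces are over $\mathbb{K}=\mathbb{R}$ or $\mathbb{C}$, and $L(X,Z)$ denotes the bounded linear operators from $X$ to $Z$. $\ell^p((X_k)_k,\mathbb{N})=\{(x_k)_{k}\in\prod_k X_k:\sum_k\|x_k\|^p<\infty\}$ with norm $(\sum_k\|x_k\|^p)^{1/p}$, and $c_0((X_k)_k,\mathbb{N})=\{(x_k)_k\in\prod_k X_k:\lim_{k\to\infty}\|x_k\|=0\}$ with norm $\sup_k\|x_k\|$. The shift is $B_{(T_k)}(x_k)_{k\in\mathbb{N}}=(T_{k+1}x_{k+1})_{k\in\mathbb{N}}$; it is a bounded operator because $\sup_k\|T_k\|<\infty$. For $k<n$, $T_{k,n}=T_{k+1}\circ\cdots\circ T_n\in L(X_n,X_k)$, and $T_{n,n}=I$. $B_k(x,r)$ is the open ball of $X_k$ centered at $x$ with radius $r$. An operator $S$ on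 a Banach space $Y$ is mixing if for all non-empty open sets $U,V\subset Y$ the set $\{n\ge 0:S^nU\cap V\neq\emptyset\}$ is cofinite. *)

(* Defs.v *)
From Stdlib Require Import Reals Lra Lia Psatz.
From Stdlib Require Import FunctionalExtensionality ProofIrrelevance Classical.
From Coquelicot Require Import Coquelicot.
Open Scope R_scope.

(* Real power of a nonnegative base, with 0 ^ p = 0
   (Stdlib has Rpower 0 p = 1). *)
Definition rpow (x p : R) : R := if Rle_dec x 0 then 0 else Rpower x p.

Lemma rpow_ge0 x p : 0 <= rpow x p.
Proof. unfold rpow, Rpower; destruct Rle_dec; [lra|left; apply exp_pos]. Qed.

Lemma rpow_le0 x p : x <= 0 -> rpow x p = 0.
Proof. intros; unfold rpow; destruct Rle_dec; lra. Qed.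

Lemma rpow_pos x p : 0 < x -> rpow x p = Rpower x p.
Proof. intros; unfold rpow; destruct Rle_dec; lra. Qed.

Lemma rpow_gt0 x p : 0 < x -> 0 < rpow x p.
Proof. intros; rewrite rpow_pos by auto; apply exp_pos. Qed.

Lemma rpow_mono x y p : 0 < p -> x <= y -> rpow x p <= rpow y p.
Proof.
  intros hp h; destruct (Rle_dec x 0).
  - rewrite (rpow_le0 x) by auto; apply rpow_ge0.
  - rewrite !rpow_pos by lra; apply Rle_Rpower_l; lra.
Qed.

Lemma rpow_mult x y p :
  0 <= x -> 0 <= y -> rpow (x * y) p = rpow x p * rpow y p.
Proof.
  intros hx hy; destruct (Req_dec x 0); [subst|destruct (Req_dec y 0); [subst|]].
  - rewrite Rmult_0_l, rpow_le0 by lra; ring.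
  - rewrite Rmult_0_r, rpow_le0 by lra; ring.
  - rewrite !rpow_pos by nra. symmetry; apply Rpower_mult_distr; lra.
Qed.

Lemma rpow_comp x a b : 0 <= x -> a * b = 1 -> rpow (rpow x a) b = x.
Proof.
  intros hx hab; destruct (Req_dec x 0).
  - subst; rewrite !rpow_le0; try lra; rewrite rpow_le0; lra.
  - rewrite (rpow_pos x) by lra; rewrite rpow_pos by apply exp_pos.
    rewrite Rpower_mult, hab, Rpower_1; lra.
Qed.

Lemma rpow_rootK x p : 1 <= p -> 0 <= x -> rpow (rpow x p) (/ p) = x.
Proof. intros; apply rpow_comp; auto; field; lra. Qed.

Lemma rootK_rpow x p : 1 <= p -> 0 <= x -> rpow (rpow x (/ p)) p = x.
Proof. intros; apply rpow_comp; auto; field; lra. Qed.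

Lemma rpow_bernoulli w p : 1 <= p -> 0 <= w -> 1 + p * (w - 1) <= rpow w p.
Proof.
  intros hp hw; destruct (Req_dec w 0).
  - subst; rewrite rpow_le0; lra.
  - rewrite rpow_pos by lra; unfold Rpower.
    rewrite <- (exp_ln w) at 1 by lra.
    set (L := ln w).
    pose proof (exp_ineq1_le ((p - 1) * L)) as h1.
    pose proof (exp_ineq1_le (- L)) as h2.
    pose proof (exp_pos L) as h3.
    replace (p * L) with (L + (p - 1) * L) by ring.
    rewrite exp_plus.
    assert (h4 : exp L * exp (- L) = 1)
      by (rewrite <- exp_plus; replace (L + - L) with 0 by ring; apply exp_0).
    apply Rmult_le_compat_l with (r := exp L) in h1; [|lra].
    apply Rmult_le_compat_l with (r := exp L) in h2; [|lra].
    apply Rle_trans with (2 := h1).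
    rewrite h4 in h2.
    apply Rmult_le_compat_l with (r := p - 1) in h2; [|lra].
    lra.
Qed.

Lemma rpow_convex l m u v p :
  1 <= p -> 0 <= l -> 0 <= m -> l + m = 1 -> 0 <= u -> 0 <= v ->
  rpow (l * u + m * v) p <= l * rpow u p + m * rpow v p.
Proof.
  intros hp hl hm hlm hu hv.
  set (c := l * u + m * v).
  destruct (Rle_dec c 0) as [h|h].
  - rewrite rpow_le0 by auto.
    pose proof (rpow_ge0 u p); pose proof (rpow_ge0 v p); nra.
  - assert (hc : 0 < c) by lra.
    assert (hs : forall t, 0 <= t -> rpow c p * (1 + p * (t / c - 1)) <= rpow t p).
    { intros t ht.
      assert (htc : 0 <= t / c)
        by (apply Rmult_le_pos; [auto|left; apply Rinv_0_lt_compat; auto]).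
      replace (rpow t p) with (rpow (c * (t / c)) p)
        by (f_equal; field; lra).
      rewrite rpow_mult by lra.
      apply Rmult_le_compat_l; [apply rpow_ge0|apply rpow_bernoulli; lra]. }
    pose proof (hs u hu); pose proof (hs v hv).
    assert (e : l * (u / c) + m * (v / c) = 1)
      by (unfold c in *; field; lra).
    apply Rle_trans with
      (l * (rpow c p * (1 + p * (u / c - 1)))
       + m * (rpow c p * (1 + p * (v / c - 1)))); [|nra].
    right.
    transitivity
      (rpow c p * ((l + m) * (1 - p) + p * (l * (u / c) + m * (v / c))));
      [rewrite e, hlm|]; ring.
Qed.

(* A norm on a linear subspace of the product of the X k. *)
Record seq_norm {K : AbsRing} (X : nat -> CompleteNormedModule K) := SeqNorm {
  sn_dom : (forall k, X k) -> Prop;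
  sn_norm : (forall k, X k) -> R;
  sn_dom0 : sn_dom (fun k => zero);
  sn_domD : forall x y, sn_dom x -> sn_dom y ->
    sn_dom (fun k => plus (x k) (y k));
  sn_domZ : forall (l : K) x, sn_dom x -> sn_dom (fun k => scal l (x k));
  sn_normD : forall x y, sn_dom x -> sn_dom y ->
    sn_norm (fun k => plus (x k) (y k)) <= sn_norm x + sn_norm y;
  sn_normZ : forall (l : K) x, sn_dom x ->
    sn_norm (fun k => scal l (x k)) <= abs l * sn_norm x;
  sn_norm_eq0 : forall x, sn_dom x -> sn_norm x = 0 -> forall k, x k = zero
}.
Arguments sn_dom {K X}.
Arguments sn_norm {K X}.

Section SeqSpace.
Context {K : AbsRing} {X : nat -> CompleteNormedModule K} (N : seq_norm X).

Definition seq_car : Type := { x : forall k, X k | sn_dom N x }.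

Lemma seq_ext (x y : seq_car) :
  (forall k, proj1_sig x k = proj1_sig y k) -> x = y.
Proof.
  destruct x as [x hx], y as [y hy]; cbn; intros h.
  assert (e : x = y) by (apply functional_extensionality_dep; auto).
  subst y; f_equal; apply proof_irrelevance.
Qed.

Definition seq_zero : seq_car := exist _ _ (sn_dom0 X N).
Definition seq_plus (x y : seq_car) : seq_car :=
  exist _ _ (sn_domD X N _ _ (proj2_sig x) (proj2_sig y)).
Definition seq_scal (l : K) (x : seq_car) : seq_car :=
  exist _ _ (sn_domZ X N l _ (proj2_sig x)).
Definition seq_opp (x : seq_car) : seq_car := seq_scal (opp one) x.

Definition seq_AbelianMonoid_mixin : AbelianMonoid.mixin_of seq_car.
Proof.
  apply (AbelianMonoid.Mixin _ seq_plus seq_zero); intros; apply seq_ext;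
    intros k; cbn.
  - apply plus_comm.
  - apply plus_assoc.
  - apply plus_zero_r.
Defined.

Definition seq_AbelianGroup_mixin :
  AbelianGroup.mixin_of
    (AbelianMonoid.Pack seq_car seq_AbelianMonoid_mixin seq_car).
Proof.
  apply (AbelianGroup.Mixin
    (AbelianMonoid.Pack seq_car seq_AbelianMonoid_mixin seq_car) seq_opp).
  intros x; apply seq_ext; intros k; cbn. rewrite scal_opp_one. exact (plus_opp_r _).
Defined.

Definition seq_AbelianGroup_class : AbelianGroup.class_of seq_car :=
  AbelianGroup.Class seq_car seq_AbelianMonoid_mixin seq_AbelianGroup_mixin.

Definition seq_ModuleSpace_mixin :
  ModuleSpace.mixin_of K
    (AbelianGroup.Pack seq_car seq_AbelianGroup_class seq_car).
Proof.
  apply (ModuleSpace.Mixin K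
    (AbelianGroup.Pack seq_car seq_AbelianGroup_class seq_car) seq_scal);
    intros; apply seq_ext; intros k; cbn.
  - exact (scal_assoc _ _ _).
  - exact (scal_one _).
  - exact (scal_distr_l _ _ _).
  - exact (scal_distr_r _ _ _).
Defined.

Definition seq_nrm (x : seq_car) : R := sn_norm N (proj1_sig x).
Definition seq_minus (x y : seq_car) : seq_car := seq_plus x (seq_opp y).
Definition seq_ball (x : seq_car) (e : R) (y : seq_car) : Prop :=
  seq_nrm (seq_minus y x) < e.

Lemma seq_nrm0 : seq_nrm seq_zero <= 0.
Proof.
  pose proof (sn_normZ X N zero _ (sn_dom0 X N)) as h.
  rewrite abs_zero, Rmult_0_l in h.
  replace seq_zero with (seq_scal zero seq_zero); [exact h|].
  apply seq_ext; intros k; exact (scal_zero_r _).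
Qed.

Lemma seq_nrm_opp x : seq_nrm (seq_opp x) <= seq_nrm x.
Proof.
  pose proof (sn_normZ X N (opp one) _ (proj2_sig x)) as h.
  rewrite abs_opp_one, Rmult_1_l in h; exact h.
Qed.

Definition seq_UniformSpace_mixin : UniformSpace.mixin_of seq_car.
Proof.
  apply (UniformSpace.Mixin _ seq_zero seq_ball); unfold seq_ball.
  - intros x e; apply Rle_lt_trans with 0; [|apply cond_pos].
    replace (seq_minus x x) with seq_zero; [apply seq_nrm0|].
    apply seq_ext; intros k; cbn.
    rewrite scal_opp_one; symmetry; exact (plus_opp_r _).
  - intros x y e h; apply Rle_lt_trans with (2 := h).
    replace (seq_minus x y) with (seq_opp (seq_minus y x));
      [apply seq_nrm_opp|].
    apply seq_ext; intros k.
    assert (e' : forall a b : X k, scal (opp one) (plus a (scal (opp one) b))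
      = plus b (scal (opp one) a)).
    { intros a b; rewrite !scal_opp_one.
      transitivity (plus (opp a) (opp (opp b))); [exact (opp_plus a (opp b))|].
      transitivity (plus (opp a) b); [f_equal; exact (opp_opp b)|].
      exact (plus_comm _ _). }
    apply e'.
  - intros x y z e1 e2 h1 h2.
    apply Rle_lt_trans with (seq_nrm (seq_minus z y) + seq_nrm (seq_minus y x));
      [|lra].
    replace (seq_minus z x) with (seq_plus (seq_minus z y) (seq_minus y x));
      [apply (sn_normD X N); apply proj2_sig|].
    apply seq_ext; intros k.
    assert (e' : forall a b c : X k, plus (plus a (scal (opp one) b))
      (plus b (scal (opp one) c)) = plus a (scal (opp one) c)).
    { intros a b c; rewrite !scal_opp_one, <- plus_assoc; f_equal.
      rewrite plus_assoc.
      transitivity (plus zero (opp c)); [f_equal; exact (plus_opp_l b)|].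
      exact (plus_zero_l _). }
    apply e'.
Defined.

Definition seq_NormedModuleAux_class : NormedModuleAux.class_of K seq_car :=
  NormedModuleAux.Class K seq_car
    (ModuleSpace.Class K seq_car seq_AbelianGroup_class seq_ModuleSpace_mixin)
    seq_UniformSpace_mixin.

Definition seq_NormedModule_mixin :
  NormedModule.mixin_of K
    (NormedModuleAux.Pack K seq_car seq_NormedModuleAux_class seq_car).
Proof.
  apply (NormedModule.Mixin K
    (NormedModuleAux.Pack K seq_car seq_NormedModuleAux_class seq_car)
    seq_nrm 1).
  - intros x y; apply (sn_normD X N); apply proj2_sig.
  - intros l x; apply (sn_normZ X N); apply proj2_sig.
  - intros x y e h; exact h.
  - intros x y e h; rewrite Rmult_1_l; exact h.
  - intros x h; apply seq_ext; apply (sn_norm_eq0 X N); [apply proj2_sig|exact h].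
Defined.

Definition seq_space : NormedModule K :=
  NormedModule.Pack K seq_car
    (NormedModule.Class K seq_car seq_NormedModuleAux_class
       seq_NormedModule_mixin) seq_car.

End SeqSpace.

Lemma is_series_0 : is_series (fun _ : nat => 0) 0.
Proof.
  intros P [e hP]; exists 0%nat; intros n _; apply hP.
  assert (h : sum_n (fun _ : nat => 0) n = 0).
  { rewrite sum_n_const; apply Rmult_0_r. }
  change (ball 0 e (sum_n (fun _ : nat => 0) n)); rewrite h.
  apply ball_center.
Qed.

Lemma ex_series_mult_l (c : R) (a : nat -> R) :
  ex_series a -> ex_series (fun k => c * a k).
Proof. exact (@ex_series_scal R_AbsRing R_NormedModule c a). Qed.

Section Lp.
Context {K : AbsRing} (X : nat -> CompleteNormedModule K) (p : R) (hp : 1 <= p).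

Definition lp_dom (x : forall k, X k) : Prop :=
  ex_series (fun k => rpow (norm (x k)) p).
Definition lp_norm (x : forall k, X k) : R :=
  rpow (Series (fun k => rpow (norm (x k)) p)) (/ p).

Lemma Series_ge0 (a : nat -> R) : (forall k, 0 <= a k) -> ex_series a -> 0 <= Series a.
Proof.
  intros h ha.
  replace 0 with (Series (fun _ => 0)).
  - apply Series_le; auto; intros n; split; [lra|auto].
  - apply is_series_unique, is_series_0.
Qed.

Lemma ex_series_ge0_le (a b : nat -> R) :
  (forall k, 0 <= a k <= b k) -> ex_series b -> ex_series a.
Proof.
  intros h hb; apply (@ex_series_le R_AbsRing R_CompleteNormedModule a b); auto.
  intros n; change (Rabs (a n) <= b n).
  rewrite Rabs_pos_eq; apply h.
Qed.

Lemma lp_sum_ge0 x : lp_dom x -> 0 <= Series (fun k => rpow (norm (x k)) p).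
Proof. intros; apply Series_ge0; auto; intros; apply rpow_ge0. Qed.

Lemma lp_norm_lt x a : lp_dom x -> lp_norm x < a ->
  0 < a /\ Series (fun k => rpow (norm (x k)) p) <= rpow a p.
Proof.
  unfold lp_norm; intros hx h.
  pose proof (rpow_ge0 (Series (fun k => rpow (norm (x k)) p)) (/ p)).
  split; [lra|].
  rewrite <- (rootK_rpow (Series _) p hp) by (apply lp_sum_ge0; auto).
  apply rpow_mono; lra.
Qed.

Lemma lp_minkowski x y a b : lp_dom x -> lp_dom y ->
  lp_norm x < a -> lp_norm y < b ->
  lp_dom (fun k => plus (x k) (y k)) /\
  lp_norm (fun k => plus (x k) (y k)) <= a + b.
Proof.
  intros hx hy ha hb.
  destruct (lp_norm_lt x a hx ha) as [a0 ha'].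
  destruct (lp_norm_lt y b hy hb) as [b0 hb'].
  set (c := rpow (a + b) p).
  assert (hc : 0 < c) by (apply rpow_gt0; lra).
  assert (ap : 0 < rpow a p) by (apply rpow_gt0; lra).
  assert (bp : 0 < rpow b p) by (apply rpow_gt0; lra).
  set (u := c * (a / (a + b)) * / rpow a p).
  set (v := c * (b / (a + b)) * / rpow b p).
  assert (u0 : 0 < u)
    by (repeat (apply Rmult_lt_0_compat || apply Rinv_0_lt_compat); lra).
  assert (v0 : 0 < v)
    by (repeat (apply Rmult_lt_0_compat || apply Rinv_0_lt_compat); lra).
  assert (hk : forall k, 0 <= rpow (norm (plus (x k) (y k))) p <=
     u * rpow (norm (x k)) p + v * rpow (norm (y k)) p).
  { intros k; split; [apply rpow_ge0|].
    set (A := norm (x k)); set (B := norm (y k)).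
    assert (A0 : 0 <= A) by apply norm_ge_0.
    assert (B0 : 0 <= B) by apply norm_ge_0.
    apply Rle_trans with (rpow (A + B) p);
      [apply rpow_mono; [lra|exact (norm_triangle (x k) (y k))]|].
    assert (A1 : 0 <= A / a)
      by (apply Rmult_le_pos; [auto|left; apply Rinv_0_lt_compat; auto]).
    assert (B1 : 0 <= B / b)
      by (apply Rmult_le_pos; [auto|left; apply Rinv_0_lt_compat; auto]).
    assert (i0 : 0 < / (a + b)) by (apply Rinv_0_lt_compat; lra).
    assert (la : 0 <= a / (a + b)) by (unfold Rdiv; apply Rmult_le_pos; lra).
    assert (lb : 0 <= b / (a + b)) by (unfold Rdiv; apply Rmult_le_pos; lra).
    replace (A + B)
      with ((a + b) * (a / (a + b) * (A / a) + b / (a + b) * (B / b)))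
      by (field; lra).
    rewrite rpow_mult
      by (try lra; apply Rplus_le_le_0_compat; apply Rmult_le_pos; assumption).
    assert (eA : rpow A p = rpow a p * rpow (A / a) p)
      by (rewrite <- rpow_mult by lra; f_equal; field; lra).
    assert (eB : rpow B p = rpow b p * rpow (B / b) p)
      by (rewrite <- rpow_mult by lra; f_equal; field; lra).
    rewrite eA, eB.
    replace (u * _ + _) with
      (c * (a / (a + b) * rpow (A / a) p + b / (a + b) * rpow (B / b) p))
      by (unfold u, v; field; lra).
    apply Rmult_le_compat_l; [lra|].
    apply rpow_convex; auto.
    field; lra. }
  assert (hs : ex_series (fun k =>
     u * rpow (norm (x k)) p + v * rpow (norm (y k)) p)).
  { apply (@ex_series_plus R_AbsRing R_NormedModule
      (fun k => u * rpow (norm (x k)) p) (fun k => v * rpow (norm (y k)) p)).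
    - exact (ex_series_mult_l u _ hx).
    - exact (ex_series_mult_l v _ hy). }
  split.
  - apply (ex_series_ge0_le _ _ hk hs).
  - unfold lp_norm.
    rewrite <- (rpow_rootK (a + b) p hp) by lra.
    apply rpow_mono; [apply Rinv_0_lt_compat; lra|].
    apply Rle_trans with (1 := Series_le _ _ hk hs).
    rewrite Series_plus, !Series_scal_l;
      [|exact (ex_series_mult_l u _ hx)
       |exact (ex_series_mult_l v _ hy)].
    apply Rle_trans with (u * rpow a p + v * rpow b p); [nra|].
    right; unfold u, v; fold c; field; lra.
Qed.

Lemma lp_scal (l : K) x : lp_dom x ->
  lp_dom (fun k => scal l (x k)) /\
  lp_norm (fun k => scal l (x k)) <= abs l * lp_norm x.
Proof.
  intros hx.
  assert (hk : forall k, 0 <= rpow (norm (scal l (x k))) p <=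
     rpow (abs l) p * rpow (norm (x k)) p).
  { intros k; split; [apply rpow_ge0|].
    rewrite <- rpow_mult by (apply abs_ge_0 || apply norm_ge_0).
    apply rpow_mono; [lra|exact (norm_scal l (x k))]. }
  pose proof (ex_series_mult_l (rpow (abs l) p) _ hx) as hs.
  split.
  - exact (ex_series_ge0_le _ _ hk hs).
  - unfold lp_norm.
    rewrite <- (rpow_rootK (abs l) p hp) at 1 by apply abs_ge_0.
    rewrite <- rpow_mult by (apply rpow_ge0 || apply lp_sum_ge0; auto).
    apply rpow_mono; [apply Rinv_0_lt_compat; lra|].
    rewrite <- Series_scal_l.
    exact (Series_le _ _ hk hs).
Qed.

Lemma lp_dom0 : lp_dom (fun k => zero).
Proof.
  unfold lp_dom; exists 0.
  apply (is_series_ext (fun _ => 0)).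
  - intros k; symmetry; apply rpow_le0; right; exact norm_zero.
  - exact is_series_0.
Qed.

Lemma lp_norm_eq0 x : lp_dom x -> lp_norm x = 0 -> forall k, x k = zero.
Proof.
  intros hx h k; refine (norm_eq_zero (x k) _).
  unfold lp_norm in h.
  set (a := fun k => rpow (norm (x k)) p) in *.
  assert (a0 : forall k, 0 <= a k) by (intros; apply rpow_ge0).
  assert (S0 : Series a <= 0).
  { destruct (Rle_dec (Series a) 0); auto.
    pose proof (rpow_gt0 (Series a) (/ p)); lra. }
  assert (ak : a k <= Series a).
  { rewrite (Series_incr_n a (S k)); [|lia|exact hx].
    assert (h1 : 0 <= Series (fun i => a (S k + i)%nat)).
    { apply Series_ge0; auto. apply (ex_series_incr_n a (S k)); exact hx. }
    assert (h2 : a k <= sum_f_R0 a k).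
    { destruct k; cbn; [lra|]. pose proof (cond_pos_sum a k a0); lra. }
    replace (pred (S k)) with k by reflexivity. lra. }
  pose proof (norm_ge_0 (x k)).
  destruct (Rle_dec (norm (x k)) 0); [apply Rle_antisym; auto|].
  assert (0 < a k) by (apply rpow_gt0; lra). lra.
Qed.

Definition lp_seq_norm : seq_norm X.
Proof.
  apply (SeqNorm K X lp_dom lp_norm).
  - exact lp_dom0.
  - intros x y hx hy.
    apply (lp_minkowski x y (lp_norm x + 1) (lp_norm y + 1) hx hy); lra.
  - intros l x hx; apply lp_scal; auto.
  - intros x y hx hy; apply le_epsilon; intros e he.
    destruct (lp_minkowski x y (lp_norm x + e / 2) (lp_norm y + e / 2) hx hy);
      lra.
  - intros l x hx; apply lp_scal; auto.
  - exact lp_norm_eq0.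
Defined.

Definition lp : NormedModule K := seq_space lp_seq_norm.

End Lp.

Section C0.
Context {K : AbsRing} (X : nat -> CompleteNormedModule K).

Definition c0_dom (x : forall k, X k) : Prop :=
  is_lim_seq (fun k => norm (x k)) 0.
Definition c0_norm (x : forall k, X k) : R :=
  real (Sup_seq (fun k => Finite (norm (x k)))).

Lemma c0_sup x : c0_dom x ->
  (forall k, norm (x k) <= c0_norm x) /\
  (forall M, (forall k, norm (x k) <= M) -> c0_norm x <= M).
Proof.
  intros hx.
  destruct (filterlim_bounded (fun k => norm (x k) : R_NormedModule)) as [M hM].
  { exists 0; exact hx. }
  assert (hM' : forall k, norm (x k) <= M)
    by (intros k; apply Rle_trans with (2 := hM k); apply Rle_abs).
  unfold c0_norm.
  set (s := Sup_seq _).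
  assert (h1 : forall k, Rbar_le (norm (x k)) s).
  { intros k.
    exact (Sup_seq_minor_le (fun k => Finite (norm (x k))) _ k (Rle_refl _)). }
  assert (h2 : forall M, (forall k, norm (x k) <= M) -> Rbar_le s M).
  { intros M' h; apply Rbar_not_lt_le; intros c.
    apply Sup_seq_minor_lt in c; destruct c as [k hk]; cbn in hk.
    specialize (h k); lra. }
  pose proof (h1 0%nat) as h0; pose proof (h2 M hM') as h3.
  destruct s as [s| |]; cbn in *; tauto.
Qed.

Lemma c0_le (x y : forall k, X k) M : c0_dom x ->
  (forall k, norm (y k) <= M * norm (x k)) -> c0_dom y.
Proof.
  intros hx h.
  apply (is_lim_seq_le_le (fun _ => 0) _ (fun k => M * norm (x k))).
  - intros k; split; [apply norm_ge_0|apply h].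
  - apply is_lim_seq_const.
  - replace (Finite 0) with (Rbar_mult M 0) by (cbn; f_equal; ring).
    apply is_lim_seq_scal_l; exact hx.
Qed.

Definition c0_seq_norm : seq_norm X.
Proof.
  assert (hZ : forall (l : K) x, c0_dom x -> c0_dom (fun k => scal l (x k))).
  { intros l x hx; apply (c0_le x _ (abs l) hx); intros k.
    exact (norm_scal l (x k)). }
  assert (hD : forall x y, c0_dom x -> c0_dom y ->
    c0_dom (fun k => plus (x k) (y k))).
  { intros x y hx hy.
    apply (is_lim_seq_le_le (fun _ => 0) _ (fun k => norm (x k) + norm (y k))).
    - intros k; split; [apply norm_ge_0|exact (norm_triangle (x k) (y k))].
    - apply is_lim_seq_const.
    - replace (Finite 0) with (Finite (0 + 0)) by (f_equal; ring).
      apply is_lim_seq_plus'; assumption. }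
  apply (SeqNorm K X c0_dom c0_norm).
  - apply is_lim_seq_ext with (fun _ => 0); [|apply is_lim_seq_const].
    intros k; symmetry; exact norm_zero.
  - exact hD.
  - exact hZ.
  - intros x y hx hy; apply (c0_sup _ (hD _ _ hx hy)); intros k.
    apply Rle_trans with (1 := norm_triangle (x k) (y k)).
    apply Rplus_le_compat; [apply (c0_sup x hx)|apply (c0_sup y hy)].
  - intros l x hx; apply (c0_sup _ (hZ l _ hx)); intros k.
    apply Rle_trans with (1 := norm_scal l (x k)).
    apply Rmult_le_compat_l; [apply abs_ge_0|apply (c0_sup x hx)].
  - intros x hx h k; refine (norm_eq_zero (x k) _).
    pose proof (proj1 (c0_sup x hx) k); pose proof (norm_ge_0 (x k)); lra.
Defined.

Definition c0 : NormedModule K := seq_space c0_seq_norm.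

End C0.

(* +oo when T is unbounded. *)
Definition op_norm {K : AbsRing} {U V : NormedModule K} (T : U -> V) : Rbar :=
  Glb_Rbar (fun M => 0 <= M /\ forall x, norm (T x) <= M * norm x).

(* Spaces are indexed from 0: X k stands for X_{k+1}, and
   T k : X (S k) -> X k for T_{k+2}. *)
Section Shift.
Context {K : AbsRing} {X : nat -> CompleteNormedModule K}
  (T : forall k, X (S k) -> X k)
  (hT : Rbar_lt (Sup_seq (fun k => op_norm (T k))) p_infty).

Definition shift (x : forall k, X k) : forall k, X k := fun k => T k (x (S k)).

Lemma op_norm_bound : exists M, 0 <= M /\
  forall k (x : X (S k)), norm (T k x) <= M * norm x.
Proof using hT.
  assert (h : exists s : R, forall k, Rbar_le (op_norm (T k)) s).
  { pose proof (Sup_seq_correct (fun k => op_norm (T k))) as hs.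
    destruct (Sup_seq _) as [s| |]; cbn in hT, hs; try tauto.
    - exists (s + 1); intros k; apply Rbar_lt_le.
      exact (proj1 (hs (mkposreal 1 Rlt_0_1)) k).
    - exists 0; intros k; apply Rbar_lt_le; apply (hs 0). }
  destruct h as [s hs]; exists (Rabs s + 1).
  split; [pose proof (Rabs_pos s); lra|].
  intros k x; specialize (hs k).
  unfold op_norm in hs.
  destruct (Glb_Rbar_correct
    (fun M => 0 <= M /\ forall x, norm (T k x) <= M * norm x)) as [_ hg].
  set (E := fun M => 0 <= M /\ forall x, norm (T k x) <= M * norm x) in *.
  destruct (classic (exists M, E M /\ M <= Rabs s + 1)) as [[M [[_ hM] hMs]]|c].
  - apply Rle_trans with (1 := hM x).
    apply Rmult_le_compat_r; [apply norm_ge_0|auto].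
  - exfalso.
    assert (hl : Rbar_le (Rabs s + 1) (Glb_Rbar E)).
    { apply hg; intros M hM; cbn.
      destruct (Rle_dec M (Rabs s + 1)); [|lra]. exfalso; eauto. }
    pose proof (Rbar_le_trans _ _ _ hl hs) as h; cbn in h.
    pose proof (Rle_abs s); lra.
Qed.

Lemma shift_lp_dom (p : R) (hp : 1 <= p) x :
  lp_dom X p x -> lp_dom X p (shift x).
Proof using hT.
  intros hx; destruct op_norm_bound as [M [M0 hM]].
  apply (ex_series_ge0_le _ (fun k => rpow M p * rpow (norm (x (S k))) p)).
  - intros k; split; [apply rpow_ge0|].
    rewrite <- rpow_mult by (auto; apply norm_ge_0).
    apply rpow_mono; [lra|apply hM].
  - apply (ex_series_mult_l (rpow M p)
             (fun k => rpow (norm (x (S k))) p)).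
    apply (ex_series_incr_1 (fun k => rpow (norm (x k)) p)); exact hx.
Qed.

Lemma shift_c0_dom x : c0_dom X x -> c0_dom X (shift x).
Proof using hT.
  intros hx; destruct op_norm_bound as [M [M0 hM]].
  apply (is_lim_seq_le_le (fun _ => 0) _ (fun k => M * norm (x (S k)))).
  - intros k; split; [apply norm_ge_0|apply hM].
  - apply is_lim_seq_const.
  - replace (Finite 0) with (Rbar_mult M 0) by (cbn; f_equal; ring).
    apply is_lim_seq_scal_l.
    apply (is_lim_seq_incr_1 (fun k => norm (x k))); exact hx.
Qed.

Definition shift_lp (p : R) (hp : 1 <= p) (x : lp X p hp) : lp X p hp :=
  exist _ (shift (proj1_sig x)) (shift_lp_dom p hp _ (proj2_sig x)).

Definition shift_c0 (x : c0 X) : c0 X :=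
  exist _ (shift (proj1_sig x)) (shift_c0_dom _ (proj2_sig x)).

(* T_{j,j+n}; the index is written n + j so that S n + j reduces to
   S (n + j). *)
Fixpoint T_comp (j n : nat) : X (n + j)%nat -> X j :=
  match n with
  | O => fun x => x
  | S m => fun x => T_comp j m (T (m + j)%nat x)
  end.

End Shift.

Definition mixing {K : AbsRing} {Y : NormedModule K} (S : Y -> Y) : Prop :=
  forall U V : Y -> Prop,
    open U -> (exists y, U y) -> open V -> (exists y, V y) ->
    eventually (fun n => exists y, U y /\ V (Nat.iter n S y)).

(* Main.v *)
(** A vector is called reachable if it is approximated by [S^n y] with [y]
    arbitrarily small, for all large [n]; it is called nilpotently approximable
    if it is a limit of vectors killed by all large powers of [S].  If every
    vector is both, [S] is mixing: perturb a killed vector of the source open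
    set by a small [y] whose [n]-th iterate hits the target.  Both properties
    are stable under sums and limits, so for the shift it suffices to check
    them on vectors supported at a single index, whose span is dense.  There
    nilpotent approximability is clear, and reachability is condition (2) after
    rescaling.  Conversely, (2) is read off a coordinate of a vector of the unit
    ball sent by [S^n] into a prescribed open set. *)

Require Import Defs.
From Stdlib Require Import Reals Lra Lia.
From Coquelicot Require Import Coquelicot.
Open Scope R_scope.

(** * Norm estimates and norm balls *)

Lemma minus_plus4 {G : AbelianGroup} (a b c d : G) :
  minus (plus a b) (plus c d) = plus (minus a c) (minus b d).
Proof.
  unfold minus; rewrite opp_plus, <- !plus_assoc; f_equal.
  rewrite !plus_assoc; f_equal; apply plus_comm.
Qed.

Section NormBalls.
Context {K : AbsRing} {Y : NormedModule K}.

Lemma norm_minus_plus (a b c d : Y) : norm (minus (plus a b) (plus c d))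
  <= norm (minus a c) + norm (minus b d).
Proof.
  replace (minus (plus a b) (plus c d)) with (plus (minus a c) (minus b d))
    by (symmetry; exact (minus_plus4 a b c d)).
  exact (norm_triangle _ _).
Qed.

Lemma norm_minus_zero_r (y : Y) : norm (minus y (zero : Y)) = norm y.
Proof. f_equal; exact (minus_zero_r y). Qed.

Lemma norm_minus_self_lt (y : Y) (r : R) : 0 < r -> norm (minus y y) < r.
Proof.
  intros hr; replace (minus y y) with (zero : Y)
    by (symmetry; exact (minus_eq_zero y)).
  rewrite norm_zero; exact hr.
Qed.

Lemma norm_minus_trans (b a c : Y) (r s : R) :
  norm (minus a b) < r -> norm (minus b c) <= s -> norm (minus a c) < r + s.
Proof.
  intros h1 h2; rewrite (minus_trans b a c).
  apply Rle_lt_trans with (1 := norm_triangle _ _); lra.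
Qed.

(** [open] refers to the uniform structure; this lemma and the next translate between it and norm
    balls. *)
Lemma open_ball_norm (b : Y) (r : R) : open (fun x : Y => norm (minus x b) < r).
Proof.
  intros x hx; apply locally_le_locally_norm.
  assert (h : 0 < r - norm (minus x b)) by lra.
  exists (mkposreal _ h); intros y hy; unfold ball_norm in hy; cbn in hy.
  replace r with ((r - norm (minus x b)) + norm (minus x b)) by ring.
  apply (norm_minus_trans x); [exact hy|apply Rle_refl].
Qed.

Lemma open_contains_ball_norm (U : Y -> Prop) (x : Y) : open U -> U x ->
  exists e, 0 < e /\ forall y, norm (minus y x) < e -> U y.
Proof.
  intros hU hx; destruct (locally_norm_le_locally x U (hU x hx)) as [e he].
  exists e; split; [apply cond_pos|exact he].
Qed.

End NormBalls.

(** Serves to shrink the unit ball to radius [e] and undo the scaling on the target; an abstract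
    [AbsRing] need not contain such scalars. *)
Lemma abs_small_invertible (K : AbsRing) (hK : K = R_AbsRing \/ K = C_AbsRing)
  (e : R) : 0 < e -> exists c c' : K, abs c <= e /\ mult c c' = one.
Proof.
  intros he; destruct hK; subst K.
  - exists e, (/ e); split.
    + right; apply Rabs_pos_eq; lra.
    + apply Rinv_r; lra.
  - exists (RtoC e), (RtoC (/ e)); split.
    + right; change (Cmod (RtoC e) = e); rewrite Cmod_R; apply Rabs_pos_eq; lra.
    + change (Cmult (RtoC e) (RtoC (/ e)) = RtoC 1).
      rewrite <- RtoC_mult; f_equal; apply Rinv_r; lra.
Qed.

(** * Mixing from reachability and nilpotent approximation *)

Section Approximation.
Context {K : AbsRing} {Y : NormedModule K} (S : Y -> Y).

Definition reachable (v : Y) : Prop := forall e, 0 < e ->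
  eventually (fun n => exists y,
    norm y < e /\ norm (minus (Nat.iter n S y) v) < e).

Definition nilpotently_approximable (u : Y) : Prop := forall e, 0 < e ->
  exists u', norm (minus u' u) < e /\
    eventually (fun n => Nat.iter n S u' = zero).

Context (iter_plus : forall n x y,
  Nat.iter n S (plus x y) = plus (Nat.iter n S x) (Nat.iter n S y)).

Lemma mixing_of_approximation :
  (forall v, reachable v) -> (forall u, nilpotently_approximable u) ->
  mixing S.
Proof using iter_plus.
  intros hr hn U V hU [u Uu] hV [v Vv].
  destruct (open_contains_ball_norm U u hU Uu) as [d [d0 hd]].
  destruct (open_contains_ball_norm V v hV Vv) as [e [e0 he]].
  destruct (hn u (d / 2)) as [u' [hu' hz]]; [lra|].
  (* The bound [d / 2] on [y] keeps [u' + y] within [d] of [u]; the bound [e] puts [S^n y] in the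
     ball around [v]. *)
  assert (hm : 0 < Rmin (d / 2) e) by (apply Rmin_glb_lt; lra).
  generalize (filter_and _ _ hz (hr v _ hm)); apply filter_imp.
  intros n [hz' [y [hy hv]]].
  pose proof (Rmin_l (d / 2) e); pose proof (Rmin_r (d / 2) e).
  exists (plus u' y); split.
  - apply hd.
    replace u with (plus u zero) by apply plus_zero_r.
    apply Rle_lt_trans with (1 := norm_minus_plus _ _ _ _).
    rewrite norm_minus_zero_r; lra.
  - apply he; rewrite iter_plus, hz', plus_zero_l; lra.
Qed.

Lemma reachable_plus x y : reachable x -> reachable y -> reachable (plus x y).
Proof using iter_plus.
  intros hx hy e he; assert (he2 : 0 < e / 2) by lra.
  generalize (filter_and _ _ (hx _ he2) (hy _ he2)); apply filter_imp.
  intros n [[a [ha ha']] [b [hb hb']]]; exists (plus a b); split.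
  - apply Rle_lt_trans with (1 := norm_triangle _ _); lra.
  - rewrite iter_plus.
    apply Rle_lt_trans with (1 := norm_minus_plus _ _ _ _); lra.
Qed.

(** The small [y] that reaches a nearby [t] also reaches [x]: only the target moves. *)
Lemma reachable_closed (x : Y) :
  (forall e, 0 < e -> exists t, norm (minus t x) < e /\ reachable t) ->
  reachable x.
Proof.
  intros h e he; destruct (h (e / 2)) as [t [ht hr]]; [lra|].
  assert (he2 : 0 < e / 2) by lra.
  generalize (hr _ he2); apply filter_imp.
  intros n [y [hy hy']]; exists y; split; [lra|].
  replace e with (e / 2 + e / 2) by field.
  apply (norm_minus_trans t); [assumption|left; assumption].
Qed.

Lemma nilpotently_approximable_plus x y : nilpotently_approximable x ->
  nilpotently_approximable y -> nilpotently_approximable (plus x y).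
Proof using iter_plus.
  intros hx hy e he.
  destruct (hx (e / 2)) as [a [ha ha']]; [lra|].
  destruct (hy (e / 2)) as [b [hb hb']]; [lra|].
  exists (plus a b); split.
  - apply Rle_lt_trans with (1 := norm_minus_plus _ _ _ _); lra.
  - generalize (filter_and _ _ ha' hb'); apply filter_imp.
    intros n [h1 h2]; rewrite iter_plus, h1, h2; apply plus_zero_l.
Qed.

Lemma nilpotently_approximable_closed (x : Y) :
  (forall e, 0 < e ->
    exists t, norm (minus t x) < e /\ nilpotently_approximable t) ->
  nilpotently_approximable x.
Proof.
  intros h e he; destruct (h (e / 2)) as [t [ht hr]]; [lra|].
  destruct (hr (e / 2)) as [u [hu hu']]; [lra|].
  exists u; split; [|exact hu'].
  replace e with (e / 2 + e / 2) by field.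
  apply (norm_minus_trans t); [assumption|left; assumption].
Qed.

End Approximation.

(** * Vectors supported at a single index *)

Section Single.
Context {K : AbsRing} {X : nat -> CompleteNormedModule K}.

(** The coordinates have different types, so [a] is transported along a proof of [k = i]. *)
Definition single (k : nat) (a : X k) : forall i, X i := fun i =>
  match Nat.eq_dec k i with
  | left e => eq_rect k (fun i => X i) a i e
  | right _ => zero
  end.

Lemma single_eq k a : single k a k = a.
Proof.
  unfold single; destruct (Nat.eq_dec k k) as [e|]; [|congruence].
  now rewrite (Eqdep_dec.UIP_refl_nat k e).
Qed.

Lemma single_neq k a i : k <> i -> single k a i = zero.
Proof. unfold single; destruct (Nat.eq_dec k i); congruence. Qed.

Lemma norm_single k a i :
  norm (single k a i) = if Nat.eq_dec k i then norm a else 0.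
Proof.
  destruct (Nat.eq_dec k i) as [e|e].
  - destruct e; now rewrite single_eq.
  - rewrite single_neq by exact e; exact norm_zero.
Qed.

End Single.

(** The common features of ℓ^p and c_0 on which the shift argument rests. The tail condition fixes
    only the norms of the coordinates of [y], so that it applies to a truncation error, whose
    entries are those of [-x]. *)
Record solid_norm {K : AbsRing} {X : nat -> CompleteNormedModule K}
    (N : seq_norm X) : Prop := {
  solid_coord : forall x k, sn_dom N x -> norm (x k) <= sn_norm N x;
  solid_single_dom : forall k a, sn_dom N (single k a);
  solid_single_norm : forall k a, sn_norm N (single k a) <= norm a;
  solid_tail : forall x e, sn_dom N x -> 0 < e -> exists m, forall y,
    sn_dom N y -> (forall k, (k < m)%nat -> y k = zero) ->
    (forall k, (m <= k)%nat -> norm (y k) = norm (x k)) -> sn_norm N y < e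
}.

(** * Density of finitely supported sequences *)

Section GenericShift.
Context {K : AbsRing} {X : nat -> CompleteNormedModule K}
  (N : seq_norm X) (hN : solid_norm N).

Definition seq_single (k : nat) (a : X k) : seq_space N :=
  exist _ (single k a) (solid_single_dom N hN k a).

Lemma seq_plus_coord (x y : seq_space N) k :
  proj1_sig (plus x y) k = plus (proj1_sig x k) (proj1_sig y k).
Proof. reflexivity. Qed.

Lemma seq_zero_coord k : proj1_sig (zero : seq_space N) k = zero.
Proof. reflexivity. Qed.

Lemma seq_minus_coord (x y : seq_space N) k :
  proj1_sig (minus x y) k = minus (proj1_sig x k) (proj1_sig y k).
Proof.
  (* The opposite in the sequence space is defined as scaling by [opp one]. *)
  change (plus (proj1_sig x k) (scal (opp one) (proj1_sig y k))
    = minus (proj1_sig x k) (proj1_sig y k)).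
  now rewrite scal_opp_one.
Qed.

Lemma seq_norm_coord (x : seq_space N) k : norm (proj1_sig x k) <= norm x.
Proof using hN. exact (solid_coord N hN _ k (proj2_sig x)). Qed.

Lemma seq_single_minus k a b :
  minus (seq_single k a) (seq_single k b) = seq_single k (minus a b).
Proof.
  apply seq_ext; intros i; rewrite seq_minus_coord; cbn.
  destruct (Nat.eq_dec k i) as [e|e].
  - destruct e; now rewrite !single_eq.
  - rewrite !single_neq by exact e; exact (minus_zero_r (zero : X i)).
Qed.

(** Density of the span of single-index vectors, as an induction principle: truncations are finite
    sums of them, and the tail condition makes truncations converge. *)
Lemma seq_space_single_ind (P : seq_space N -> Prop) :
  (forall x y, P x -> P y -> P (plus x y)) ->
  (forall x : seq_space N,
    (forall e, 0 < e -> exists t, norm (minus t x) < e /\ P t) -> P x) ->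
  (forall k a, P (seq_single k a)) -> forall x, P x.
Proof using hN.
  intros hplus hlim hsgl x.
  assert (trunc : forall m, exists t : seq_space N, P t /\
    (forall k, (k < m)%nat -> proj1_sig t k = proj1_sig x k) /\
    (forall k, (m <= k)%nat -> proj1_sig t k = zero)).
  { induction m as [|m [t [Pt [h1 h2]]]].
    (* The empty truncation is written as a single-index vector because [P zero] is not among the
       assumptions. *)
    - exists (seq_single 0 zero); split; [apply hsgl|split; [lia|]].
      intros k _; cbn; destruct k; [apply single_eq|apply single_neq; lia].
    - exists (plus t (seq_single m (proj1_sig x m))); split; [auto|split].
      + intros k hk; rewrite seq_plus_coord; cbn.
        destruct (Nat.eq_dec m k) as [e|e].
        * destruct e; rewrite single_eq, h2 by lia; apply plus_zero_l.
        * rewrite single_neq, h1 by lia; apply plus_zero_r.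
      + intros k hk; rewrite seq_plus_coord; cbn.
        rewrite single_neq, h2 by lia; apply plus_zero_r. }
  apply hlim; intros e he.
  destruct (solid_tail N hN _ e (proj2_sig x) he) as [m hm].
  destruct (trunc m) as [t [Pt [h1 h2]]].
  exists t; split; [|exact Pt].
  apply (hm (proj1_sig (minus t x)) (proj2_sig _)).
  - intros k hk; rewrite seq_minus_coord, h1 by exact hk.
    exact (minus_eq_zero (proj1_sig x k)).
  - intros k hk; rewrite seq_minus_coord, h2 by exact hk.
    rewrite <- (norm_opp (proj1_sig x k)); f_equal; exact (plus_zero_l (opp (proj1_sig x k))).
Qed.

(** * Iterates of the shift and the equivalence for a general norm *)

Context (T : forall k, X (S k) -> X k) (hlin : forall k, is_linear (T k))
  (B : seq_space N -> seq_space N)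
  (hB : forall x, proj1_sig (B x) = shift T (proj1_sig x)).

Lemma T_comp_linear j n : is_linear (T_comp T j n).
Proof using hlin.
  induction n as [|n IH]; [apply is_linear_id|].
  exact (is_linear_comp (T (n + j)) (T_comp T j n) (hlin _) IH).
Qed.

Lemma iter_shift_coord n x k :
  proj1_sig (Nat.iter n B x) k = T_comp T k n (proj1_sig x (n + k)%nat).
Proof using hB.
  revert x; induction n as [|n IH]; intros x; [reflexivity|].
  (* [T_comp] applies the operator of highest index first, so the innermost [B] is the one peeled
     off. *)
  rewrite Nat.iter_succ_r, IH, hB; reflexivity.
Qed.

Lemma iter_shift_plus n x y :
  Nat.iter n B (plus x y) = plus (Nat.iter n B x) (Nat.iter n B y).
Proof using hB hlin.
  apply seq_ext; intros k.
  rewrite seq_plus_coord, !iter_shift_coord, seq_plus_coord.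
  apply (linear_plus _ (T_comp_linear k n)).
Qed.

Lemma iter_shift_single n j z :
  Nat.iter n B (seq_single (n + j) z) = seq_single j (T_comp T j n z).
Proof using hB hlin.
  apply seq_ext; intros k; rewrite iter_shift_coord; cbn.
  destruct (Nat.eq_dec j k) as [e|e].
  - destruct e; now rewrite !single_eq.
  - rewrite !single_neq by lia; apply (linear_zero _ (T_comp_linear k n)).
Qed.

Lemma shift_nilpotently_approximable x : nilpotently_approximable B x.
Proof using hN hB hlin.
  revert x; apply seq_space_single_ind.
  - apply nilpotently_approximable_plus, iter_shift_plus.
  - apply nilpotently_approximable_closed.
  - intros j a e he; exists (seq_single j a); split.
    + apply norm_minus_self_lt; exact he.
    (* Coordinate [k] of the [n]-th iterate reads entry [n + k], which lies beyond [j] once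
       [n > j]. *)
    + exists (S j); intros n hn; apply seq_ext; intros k.
      rewrite iter_shift_coord, seq_zero_coord; cbn.
      rewrite single_neq by lia; apply (linear_zero _ (T_comp_linear k n)).
Qed.

(** Condition (2), with the same body as [cond] in the theorem. *)
Definition ball_images_meet_open : Prop :=
  forall (j : nat) (U : X j -> Prop), open U -> (exists u, U u) ->
    exists n0 : nat, forall n : nat, (n0 <= n)%nat ->
      exists z : X (n + j)%nat, ball_norm zero 1 z /\ U (T_comp T j n z).

Lemma shift_reachable (hK : K = R_AbsRing \/ K = C_AbsRing) :
  ball_images_meet_open -> forall x, reachable B x.
Proof using hN hB hlin.
  intros hc; apply seq_space_single_ind.
  - apply reachable_plus, iter_shift_plus.
  - apply reachable_closed.
  - intros j a e he.
    destruct (abs_small_invertible K hK e he) as [c [c' [hce hcc]]].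
    (* The target is enlarged to [c' a] with tolerance 1; multiplying by [c] brings it back to [a]
       and both errors below [e]. *)
    destruct (hc j _ (open_ball_norm (scal c' a) 1)) as [n0 hn0].
    { exists (scal c' a); apply norm_minus_self_lt; lra. }
    assert (hsmall : forall (V : NormedModule K) (w : V),
      norm w < 1 -> norm (scal c w) < e).
    { intros V w hw; apply Rle_lt_trans with (1 := norm_scal c w).
      apply Rle_lt_trans with (e * norm w).
      - apply Rmult_le_compat_r; [apply norm_ge_0|exact hce].
      - rewrite <- (Rmult_1_r e) at 2; apply Rmult_lt_compat_l; assumption. }
    exists n0; intros n hn; destruct (hn0 n hn) as [z [hz hTz]].
    unfold ball_norm in hz; rewrite norm_minus_zero_r in hz.
    exists (seq_single (n + j) (scal c z)); split.
    + apply Rle_lt_trans with (1 := solid_single_norm N hN _ _).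
      apply hsmall, hz.
    + rewrite iter_shift_single, seq_single_minus.
      apply Rle_lt_trans with (1 := solid_single_norm N hN _ _).
      rewrite (linear_scal _ (T_comp_linear j n)).
      replace a with (scal c (scal c' a)).
      * apply Rle_lt_trans with (2 := hsmall _ _ hTz); right.
        symmetry; f_equal; exact (scal_minus_distr_l c _ _).
      * rewrite scal_assoc, hcc; apply scal_one.
Qed.

Lemma mixing_shift_images : mixing B -> ball_images_meet_open.
Proof using hN hB.
  intros hm j U hU [u Uu].
  destruct (open_contains_ball_norm U u hU Uu) as [e [he heU]].
  (* The source is the unit ball and the target a ball around [u] placed at index [j]; since
     coordinates are bounded by the norm, entry [n + j] of [y] is the required [z]. *)
  destruct (hm _ _ (open_ball_norm (zero : seq_space N) 1)
    (ex_intro _ zero (norm_minus_self_lt _ 1 Rlt_0_1))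
    (open_ball_norm (seq_single j u) e)
    (ex_intro _ (seq_single j u) (norm_minus_self_lt _ e he))) as [n0 hn0].
  exists n0; intros n hn; destruct (hn0 n hn) as [y [hy hy']].
  exists (proj1_sig y (n + j)%nat); split.
  - unfold ball_norm; rewrite norm_minus_zero_r; rewrite norm_minus_zero_r in hy.
    apply Rle_lt_trans with (1 := seq_norm_coord y _); exact hy.
  - rewrite <- iter_shift_coord; apply heU.
    apply Rle_lt_trans with (2 := hy').
    pose proof (seq_norm_coord (minus (Nat.iter n B y) (seq_single j u)) j) as h.
    rewrite seq_minus_coord in h; cbn [seq_single proj1_sig] in h.
    rewrite single_eq in h; exact h.
Qed.

Lemma mixing_shift_iff (hK : K = R_AbsRing \/ K = C_AbsRing) :
  mixing B <-> ball_images_meet_open.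
Proof using hN hB hlin.
  split; [exact mixing_shift_images|].
  intros hc; apply mixing_of_approximation.
  - apply iter_shift_plus.
  - apply shift_reachable; assumption.
  - apply shift_nilpotently_approximable.
Qed.

End GenericShift.

(** * The norms of ℓ^p and c_0 are solid *)

Lemma is_series_indicator (k : nat) (c : R) :
  is_series (fun i => if Nat.eq_dec k i then c else 0) c.
Proof.
  assert (h : forall n, sum_n (fun i => if Nat.eq_dec k i then c else 0) n
    = if Compare_dec.le_dec k n then c else 0).
  { induction n as [|n IH].
    - rewrite sum_O; destruct (Nat.eq_dec k 0), (Compare_dec.le_dec k 0); lia || reflexivity.
    - rewrite sum_Sn, IH; unfold plus; cbn.
      destruct (Nat.eq_dec k (S n)), (Compare_dec.le_dec k n), (Compare_dec.le_dec k (S n)); lia || lra. }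
  apply (filterlim_ext_loc (fun _ => c)); [|apply filterlim_const].
  exists k; intros n hn; rewrite h; destruct (Compare_dec.le_dec k n); [reflexivity|lia].
Qed.

(** Termwise comparison with the series whose only possibly nonzero term is [a k]. *)
Lemma Series_term_le (a : nat -> R) (k : nat) :
  (forall i, 0 <= a i) -> ex_series a -> a k <= Series a.
Proof.
  intros a0 ha; rewrite <- (is_series_unique _ _ (is_series_indicator k (a k))).
  apply Series_le; [|exact ha].
  intros i; pose proof (a0 i); destruct (Nat.eq_dec k i); subst; lra.
Qed.

Lemma Series_tail_small (a : nat -> R) (e : R) : ex_series a -> 0 < e ->
  exists m, Series (fun i => a (m + i)%nat) < e.
Proof.
  intros ha he.
  assert (h : is_lim_seq (sum_n a) (Series a)) by exact (Series_correct a ha).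
  apply is_lim_seq_spec in h; destruct (h (mkposreal e he)) as [n hn].
  (* [sum_n a n] includes the term of index [n], so the remaining tail starts at [S n]. *)
  exists (S n); specialize (hn n (le_n n)).
  change (Rabs (sum_n a n - Series a) < e) in hn.
  rewrite sum_n_Reals in hn.
  pose proof (Series_incr_n a (S n) (Nat.lt_0_succ n) ha) as h'; cbn [pred] in h'.
  apply Rabs_def2 in hn; lra.
Qed.

Lemma lp_solid {K : AbsRing} (X : nat -> CompleteNormedModule K) (p : R)
  (hp : 1 <= p) : solid_norm (lp_seq_norm X p hp).
Proof.
  assert (ip : 0 < / p) by (apply Rinv_0_lt_compat; lra).
  assert (hs : forall k (a : X k), is_series
    (fun i => rpow (norm (single k a i)) p) (rpow (norm a) p)).
  { intros k a; apply (is_series_ext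
      (fun i => if Nat.eq_dec k i then rpow (norm a) p else 0));
      [|apply is_series_indicator].
    intros i; rewrite norm_single.
    destruct (Nat.eq_dec k i); [reflexivity|].
    symmetry; apply rpow_le0, Rle_refl. }
  split.
  - intros x k hx.
    rewrite <- (rpow_rootK (norm (x k)) p hp) by apply norm_ge_0.
    apply rpow_mono; [exact ip|].
    apply (Series_term_le (fun i => rpow (norm (x i)) p));
      [intros; apply rpow_ge0|exact hx].
  - intros k a; exists (rpow (norm a) p); apply hs.
  - intros k a; cbn; unfold lp_norm.
    rewrite (is_series_unique _ _ (hs k a)), rpow_rootK;
      [apply Rle_refl|exact hp|apply norm_ge_0].
  - intros x e hx he.
    assert (he2 : 0 < e / 2) by lra.
    (* Taking roots preserves only the weak inequality, so the tail is compared with the power of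
       [e / 2] to end strictly below [e]. *)
    destruct (Series_tail_small _ _ hx (rpow_gt0 (e / 2) p he2)) as [m hm].
    exists m; intros y hy h1 h2.
    apply Rle_lt_trans with (e / 2); [|lra].
    cbn; unfold lp_norm; rewrite <- (rpow_rootK (e / 2) p hp) by lra.
    apply rpow_mono; [exact ip|].
    left; apply Rle_lt_trans with (2 := hm); right.
    (* The first [m] terms for [y] vanish, which leaves exactly the tail for [x]. *)
    rewrite (Series_incr_n_aux (fun i => rpow (norm (y i)) p) m).
    + apply Series_ext; intros i; rewrite h2 by lia; reflexivity.
    + intros k hk; rewrite h1 by exact hk.
      apply rpow_le0; right; exact norm_zero.
Qed.

Lemma c0_solid {K : AbsRing} (X : nat -> CompleteNormedModule K) :
  solid_norm (c0_seq_norm X).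
Proof.
  assert (hd : forall k (a : X k), c0_dom X (single k a)).
  { intros k a.
    apply (is_lim_seq_ext_loc (fun _ => 0)); [|apply is_lim_seq_const].
    exists (S k); intros n hn; rewrite norm_single.
    destruct (Nat.eq_dec k n); [lia|reflexivity]. }
  split.
  - intros x k hx; apply (c0_sup X x hx).
  - exact hd.
  - intros k a; apply (c0_sup X _ (hd k a)); intros i; rewrite norm_single.
    destruct (Nat.eq_dec k i); [apply Rle_refl|apply norm_ge_0].
  - intros x e hx he; assert (he2 : 0 < e / 2) by lra.
    assert (hx' := hx); apply is_lim_seq_spec in hx'.
    destruct (hx' (mkposreal _ he2)) as [m hm]; cbn in hm.
    exists m; intros y hy h1 h2.
    (* A supremum of terms below [e / 2] is only at most [e / 2]; the slack makes the bound
       strict. *)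
    apply Rle_lt_trans with (e / 2); [|lra].
    apply (c0_sup X y hy); intros k.
    destruct (Compare_dec.le_lt_dec m k) as [h|h].
    + rewrite h2 by exact h; specialize (hm k h); apply Rabs_def2 in hm; lra.
    + rewrite h1 by exact h; apply Rle_trans with 0; [right; exact norm_zero|lra].
Qed.

Theorem proposition3p3
  (K : AbsRing) (hK : K = R_AbsRing \/ K = C_AbsRing)
  (X : nat -> CompleteNormedModule K)
  (T : forall k, X (S k) -> X k)
  (hlin : forall k, is_linear (T k))
  (hT : Rbar_lt (Sup_seq (fun k => op_norm (T k))) p_infty) :
  let cond :=
    forall (j : nat) (U : X j -> Prop), open U -> (exists u, U u) ->
      exists n0 : nat, forall n : nat, (n0 <= n)%nat ->
        exists z : X (n + j)%nat, ball_norm zero 1 z /\ U (T_comp T j n z)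
  in
  (forall (p : R) (hp : 1 <= p), mixing (shift_lp T hT p hp) <-> cond)
  /\ (mixing (shift_c0 T hT) <-> cond).
Proof.
  split.
  - intros p hp.
    (* The underlying sequence of [shift_lp] is [shift T] of the underlying sequence by definition,
       hence [eq_refl]. *)
    exact (mixing_shift_iff (lp_seq_norm X p hp) (lp_solid X p hp) T hlin
      (shift_lp T hT p hp) (fun _ => eq_refl) hK).
  - exact (mixing_shift_iff (c0_seq_norm X) (c0_solid X) T hlin
      (shift_c0 T hT) (fun _ => eq_refl) hK).
Qed.
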